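(* For all positive integers $a$ and $n$, we have \[\widehat{b}_a(n)= \sum_{j=1}^\infty b_{aj}(n).\] Moreover, for every positive integer $a$ we have the identity of formal power series \[B_a(q)=\sum_{n=1}^\infty \mu(n)\,\widehat{B}_{an}(q),\] and for all positive integers $a$ and $n$, \[b_a(n)= \sum_{j=1}^\infty \mu(j)\,\widehat{b}_{aj}(n),\] where $\mu$ denotes the Möbius function.
   Context: Let $(q)_0=1$ and $(q)_n=\prod_{k=1}^n(1-q^k)$ for $n\ge 1$. For a positive integer $a$, define the formal power series $B_a(q)$, $\widehat{B}_a(q)$ and their coefficients $b_a(N)$, $\widehat{b}_a(N)$ by \[B_a(q) := \sum_{n=1}^{\infty}\frac{q^{n^2+an}}{(q)_n^2}=:\sum_{N=1}^{\infty} b_a(N)q^N,\] \[\widehat{B}_a(q) := \sum_{n=1}^{\infty}\frac{q^{n^2+an}}{(q)_n^2\left(1-q^{an}\right)}=:\sum_{N=1}^{\infty}\widehat{b}_a(N)q^N.\] Infinite sums of formal power series are taken coefficientwise. *)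

(* Defs.v *)
From HB Require Import structures.
From mathcomp Require Import all_boot all_order all_algebra.
From mathcomp Require Import boolp classical_sets functions cardinality fsbigop.

Set Implicit Arguments.
Unset Strict Implicit.
Unset Printing Implicit Defensive.

Import Order.TTheory GRing.Theory Num.Theory.
Local Open Scope classical_set_scope.
Local Open Scope ring_scope.

(* A series coerces to its coefficient function: f N is the coefficient of    *)
(* q^N in f.                                                                  *)
Record fps (R : Type) := Fps { fps_coef :> nat -> R }.
Add Printing Constructor fps.

Lemma fpsP (R : Type) (f g : fps R) : (forall N, f N = g N) <-> f = g.
Proof.
split=> [|->//]; case: f g => [f] [g] /= fg.
by congr Fps; apply/funext.
Qed.

HB.instance Definition _ (R : Type) := gen_eqMixin (fps R).
HB.instance Definition _ (R : Type) := gen_choiceMixin (fps R).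

Section Zmodule.
Variable R : zmodType.
Implicit Types f g h : fps R.

Definition fps_zero : fps R := Fps (fun=> 0).
Definition fps_opp f : fps R := Fps (fun N => - f N).
Definition fps_add f g : fps R := Fps (fun N => f N + g N).

Fact fps_addA : associative fps_add.
Proof. by move=> f g h; apply/fpsP => N /=; rewrite addrA. Qed.
Fact fps_addC : commutative fps_add.
Proof. by move=> f g; apply/fpsP => N /=; rewrite addrC. Qed.
Fact fps_add0 : left_id fps_zero fps_add.
Proof. by move=> f; apply/fpsP => N /=; rewrite add0r. Qed.
Fact fps_addN : left_inverse fps_zero fps_opp fps_add.
Proof. by move=> f; apply/fpsP => N /=; rewrite addNr. Qed.

HB.instance Definition _ :=
  GRing.isZmodule.Build (fps R) fps_addA fps_addC fps_add0 fps_addN.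

Lemma fps_coef0 N : (0 : fps R) N = 0. Proof. by []. Qed.
Lemma fps_coefD f g N : (f + g) N = f N + g N. Proof. by []. Qed.
Lemma fps_coefN f N : (- f) N = - f N. Proof. by []. Qed.
Lemma fps_coefB f g N : (f - g) N = f N - g N. Proof. by []. Qed.

Lemma fps_coef_sum I (r : seq I) (P : pred I) (F : I -> fps R) N :
  (\sum_(i <- r | P i) F i) N = \sum_(i <- r | P i) F i N.
Proof. exact: (big_morph (fun f : fps R => f N)). Qed.

Lemma fps_coefMn f k N : (f *+ k) N = f N *+ k.
Proof. by elim: k => // k IH; rewrite !mulrSr fps_coefD IH. Qed.

Lemma fps_coefMz f (z : int) N : (f *~ z) N = f N *~ z.
Proof. by case: z => k; rewrite /intmul ?fps_coefN fps_coefMn. Qed.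

End Zmodule.

Section ComNzRing.
Variable R : comNzRingType.
Implicit Types f g h : fps R.

Definition fps_one : fps R := Fps (fun N => (N == 0)%:R).
Definition fps_mul f g : fps R :=
  Fps (fun N => \sum_(j < N.+1) f j * g (N - j)%N).

Fact fps_mulC : commutative fps_mul.
Proof.
move=> f g; apply/fpsP => N /=.
rewrite (reindex_inj rev_ord_inj) /=; apply: eq_bigr => j _.
by rewrite subSS subKn 1?mulrC // -ltnS.
Qed.

Fact fps_mulA : associative fps_mul.
Proof.
move=> f g h; apply/fpsP => N /=.
pose F i j := f i * (g (j - i)%N * h (N - j)%N).
transitivity (\sum_(i < N.+1) \sum_(j < N.+1 | (i <= j)%N) F i j).
  apply: eq_bigr => i _; rewrite big_distrr /=.
  rewrite -(big_mkord (fun j => (i <= j)%N) (F i)).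
  rewrite (@big_cat_nat _ _ _ i) //=; last by rewrite ltnW.
  rewrite [X in _ = X + _]big1_seq ?add0r; last first.
    by move=> j; rewrite mem_index_iota leqNgt => /and3P[/negPf->].
  have -> : \sum_(i <= j < N.+1 | (i <= j)%N) F i j =
            \sum_(0 + i <= j < N.+1) F i j.
    by rewrite add0n big_nat_cond [RHS]big_nat; apply: eq_bigl => j /=; rewrite andbC andbA andbb.
  rewrite big_addn big_mkord subSn; last by rewrite -ltnS.
  by apply: eq_bigr => j _; rewrite /F addnK addnC subnDA.
rewrite (exchange_big_dep predT) //=.
apply: eq_bigr => j _; rewrite big_distrl /=.
rewrite -(big_mkord (fun i => (i <= j)%N) (F^~ j)).
rewrite (big_cat_nat (n := j.+1)) //=.
rewrite [X in _ + X]big1_seq ?addr0; last first.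
  by move=> i; rewrite mem_index_iota leqNgt => /and3P[/negPf->].
rewrite big_mkord; apply: eq_big => [i|i _]; first by rewrite -ltnS ltn_ord.
by rewrite /F mulrA.
Qed.

Fact fps_mul1 : left_id fps_one fps_mul.
Proof.
move=> f; apply/fpsP => N /=.
by rewrite big_ord_recl big1 ?addr0 ?mul1r ?subn0 // => j _; rewrite mul0r.
Qed.

Fact fps_mulDl : left_distributive fps_mul (@fps_add R).
Proof.
move=> f g h; apply/fpsP => N /=.
by rewrite -big_split; apply: eq_bigr => j _; rewrite mulrDl.
Qed.

Fact fps_one_neq0 : fps_one != 0.
Proof.
by apply/eqP => /fpsP/(_ 0%N)/eqP; rewrite /= oner_eq0.
Qed.

HB.instance Definition _ := GRing.Zmodule_isComNzRing.Build (fps R)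
  fps_mulA fps_mulC fps_mul1 fps_mulDl fps_one_neq0.

Lemma fps_coef1 N : (1 : fps R) N = (N == 0)%:R. Proof. by []. Qed.
Lemma fps_coefM f g N : (f * g) N = \sum_(j < N.+1) f j * g (N - j)%N.
Proof. by []. Qed.

Definition fps_unit : {pred fps R} := fun f => `[< exists g, g * f = 1 >].
Definition fps_inv f : fps R :=
  if pselect (exists g, g * f = 1) is left ex then projT1 (cid ex) else f.

Fact fps_mulVf : {in fps_unit, left_inverse 1 fps_inv *%R}.
Proof.
move=> f /asboolP uf; rewrite /fps_inv.
by case: pselect => // ex; case: cid.
Qed.

Fact fps_unitPl f g : g * f = 1 -> fps_unit f.
Proof. by move=> gf1; apply/asboolP; exists g. Qed.

Fact fps_inv_out : {in [predC fps_unit], fps_inv =1 id}.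
Proof.
move=> f /negP nuf; rewrite /fps_inv.
by case: pselect => // ex; case: nuf; apply/asboolP.
Qed.

HB.instance Definition _ := GRing.ComNzRing_hasMulInverse.Build (fps R)
  fps_mulVf fps_unitPl fps_inv_out.

Definition fps_var : fps R := Fps (fun N => (N == 1)%:R).

Lemma fps_coefXn k N : (fps_var ^+ k) N = (N == k)%:R.
Proof.
elim: k N => [//|k IH] N; rewrite exprS fps_coefM.
case: N => [|N]; first by rewrite big_ord1 mul0r.
rewrite 2!big_ord_recl mul0r add0r mul1r big1 ?addr0 => [|j _].
  by rewrite IH subSS subn0.
by rewrite mul0r.
Qed.

Lemma fps_coefXnM k f N :
  (fps_var ^+ k * f) N = if (N < k)%N then 0 else f (N - k)%N.
Proof.
rewrite fps_coefM; case: ltnP => kN.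
  rewrite big1 // => j _; rewrite fps_coefXn; case: eqP => [jk|_].
    by have := ltn_ord j; rewrite ltnS leqNgt jk kN.
  by rewrite mul0r.
rewrite (bigD1 (Ordinal (kN : k < N.+1)%N)) //= fps_coefXn eqxx mul1r.
rewrite big1 ?addr0 // => j; rewrite -val_eqE fps_coefXn => /negPf ->.
by rewrite mul0r.
Qed.

End ComNzRing.

Notation "''q'" := (fps_var _) (at level 0) : ring_scope.

Section Unit.
Variable R : comUnitRingType.
Implicit Types f g : fps R.

Lemma fps_unitE f : (f \is a GRing.unit) = (f 0%N \is a GRing.unit).
Proof.
apply/idP/idP => [/mulVr/fpsP/(_ 0%N)|uf].
  rewrite fps_coefM big_ord1 subnn fps_coef1 => f1.
  by apply/unitrPr; exists (f^-1 0%N); rewrite mulrC.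
pose step s := rcons s
  ((f 0%N)^-1 * ((nilp s)%:R - \sum_(j < size s) f (size s - j)%N * nth 0 s j)).
pose s N := iter N step [::].
have size_s N : size (s N) = N by elim: N => //= N IH; rewrite size_rcons IH.
have nth_s N M j : (j < N)%N -> (N <= M)%N -> nth 0 (s M) j = nth 0 (s N) j.
  move=> jN; elim: M => [|M IH]; first by rewrite leqn0 => /eqP ->.
  rewrite leq_eqVlt => /predU1P[-> //|]; rewrite ltnS => NM.
  by rewrite /= nth_rcons size_s (leq_trans jN NM) IH.
apply/unitrPr; exists (Fps (fun N => nth 0 (s N.+1) N)).
apply/fpsP => N; rewrite mulrC fps_coefM big_ord_recr /= subnn.
rewrite nth_rcons size_s ltnn eqxx [X in _ + X]mulrC mulVKr //.
rewrite /nilp size_s addrC -addrA [X in _ + X]addrC.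
rewrite [X in _ - X](eq_bigr (fun j : 'I_N => nth 0 (s j.+1) j * f (N - j)%N)).
  by rewrite subrr addr0.
by move=> j _; rewrite mulrC (nth_s j.+1).
Qed.

End Unit.

Definition positives : set nat := [set n | (0 < n)%N].

(* The sum \sum_(i \in A) of fsbigop is 0 on families of infinite support;    *)
(* fps_summable says that no coefficient is in that case.                     *)
Section InfiniteSum.
Variables (R : zmodType) (I : choiceType) (A : set I) (F : I -> fps R).

Definition fps_summable :=
  forall N, finite_set (A `&` [set i | F i N != 0]).

Definition fps_sum : fps R := Fps (fun N => \sum_(i \in A) F i N).

End InfiniteSum.

Definition qpoch (n : nat) : fps int := \prod_(1 <= k < n.+1) (1 - 'q ^+ k).

Definition B_term (a n : nat) : fps int :=
  'q ^+ (n ^ 2 + a * n) / qpoch n ^+ 2.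
Definition Bhat_term (a n : nat) : fps int :=
  'q ^+ (n ^ 2 + a * n) / (qpoch n ^+ 2 * (1 - 'q ^+ (a * n))).

Definition B (a : nat) : fps int := fps_sum positives (B_term a).
Definition Bhat (a : nat) : fps int := fps_sum positives (Bhat_term a).

Definition b (a N : nat) : int := B a N.
Definition bhat (a N : nat) : int := Bhat a N.

Definition moebius (n : nat) : int :=
  if (0 < n)%N && all (fun p => logn p n == 1%N) (primes n)
  then (-1) ^+ size (primes n) else 0.

Lemma subr_Xn_unit k : (0 < k)%N -> (1 - 'q ^+ k : fps int) \is a GRing.unit.
Proof.
move=> k0; rewrite fps_unitE fps_coefB fps_coefXn fps_coef1 eqxx.
by rewrite (ltn_eqF k0) subr0 unitr1.
Qed.

Lemma qpoch_unit n : qpoch n \is a GRing.unit.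
Proof.
rewrite /qpoch big_seq; apply: (big_ind (fun f : fps int => f \is a GRing.unit)).
- exact: unitr1.
- by move=> f g uf ug; rewrite unitrM uf.
- by move=> k; rewrite mem_index_iota => /andP[k0 _]; exact: subr_Xn_unit.
Qed.

Lemma Bhat_den_unit a n : (0 < a)%N -> (0 < n)%N ->
  qpoch n ^+ 2 * (1 - 'q ^+ (a * n)) \is a GRing.unit.
Proof.
by move=> a0 n0; rewrite unitrM unitrX ?qpoch_unit ?subr_Xn_unit ?muln_gt0 ?a0.
Qed.

Lemma fps_summable_XnM (R : comNzRingType) (e : nat -> nat) (F : nat -> fps R)
    (A : set nat) :
  (forall n, n <= e n)%N -> fps_summable A (fun n => 'q ^+ e n * F n).
Proof.
move=> le_e N; apply: sub_finite_set (finite_II N.+1) => n [_]; rewrite /mkset.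
rewrite fps_coefXnM; case: ltnP => [_|eN _]; first by rewrite eqxx.
by rewrite ltnS (leq_trans (le_e n)).
Qed.

Lemma B_summable a : fps_summable positives (B_term a).
Proof.
apply: fps_summable_XnM => n.
by rewrite (leq_trans _ (leq_addr _ _)) // expnS expn1; case: n => // n; rewrite leq_pmulr.
Qed.

Lemma Bhat_summable a : fps_summable positives (Bhat_term a).
Proof.
apply: fps_summable_XnM => n.
by rewrite (leq_trans _ (leq_addr _ _)) // expnS expn1; case: n => // n; rewrite leq_pmulr.
Qed.

(* Main.v *)
(* Expanding 1 / (1 - q^(an)) as a geometric series turns the n-th term of    *)
(* Bhat_a into the sum over j >= 1 of the n-th terms of B_(aj); exchanging    *)
(* the two sums gives Bhat_a = \sum_j B_(aj), which Moebius inversion over    *)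
(* the multiples of a inverts.  The coefficient of q^N in B_a and in Bhat_a   *)
(* vanishes when N < a, so for each coefficient every infinite sum is a       *)
(* finite sum over 1 <= j <= N.                                               *)

Require Import Defs.
From mathcomp Require Import all_boot all_order all_algebra.
From mathcomp Require Import boolp classical_sets functions cardinality fsbigop.

Set Implicit Arguments.
Unset Strict Implicit.
Unset Printing Implicit Defensive.

Import GRing.Theory.
Local Open Scope classical_set_scope.
Local Open Scope ring_scope.

(** With x = q^(an), the identity 1/(1 - x) = 1 + x/(1 - x) iterates to [Bhat_term_geometric], whose
    remainder has too high an order to reach a given coefficient; this yields [bhat_sum_b].
    Conversely, [moebius_inversion] rests on [sum_moebius_divisors] and, applied to m |->
    [b (a * m) N], yields [b_sum_bhat]. The identity of series is the latter read
    coefficientwise. *)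

Lemma perm_primes_primeM (p d : nat) :
  prime p -> (0 < d)%N -> ~~ (p %| d)%N ->
  perm_eq (primes (p * d)%N) (p :: primes d).
Proof.
move=> pp d0 pd; apply: uniq_perm; first exact: primes_uniq.
  by rewrite /= primes_uniq mem_primes pp d0 pd.
by move=> r; rewrite (primesM _ (prime_gt0 pp) d0) primes_prime // !inE.
Qed.

(** The prime p is new, so squarefreeness is unaffected and the number of prime factors grows by
    one. *)
Lemma moebius_primeM (p d : nat) :
  prime p -> (0 < d)%N -> ~~ (p %| d)%N -> moebius (p * d)%N = - moebius d.
Proof.
move=> pp d0 pd; have pm := perm_primes_primeM pp d0 pd.
rewrite /moebius muln_gt0 d0 (prime_gt0 pp) /= (perm_all _ pm) (perm_size pm) /=.
have lpd : logn p d = 0%N by apply/eqP; rewrite lognE pp d0 (negPf pd).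
rewrite lognM ?(prime_gt0 pp) // lpd logn_prime // eqxx addn0 eqxx /=.
rewrite (@eq_in_all _ _ (fun r => logn r d == 1%N)).
  by case: ifP => _; rewrite ?oppr0 // exprS mulN1r.
move=> r; rewrite mem_primes => /and3P[pr _ rd].
rewrite lognM ?(prime_gt0 pp) // logn_prime // (_ : (r == p) = false) //.
by apply/eqP => rp; rewrite rp (negPf pd) in rd.
Qed.

Lemma moebius_square (p d : nat) :
  prime p -> (p ^ 2 %| d)%N -> moebius d = 0.
Proof.
move=> pp; rewrite /moebius; case: posnP => [//|d0] /=; rewrite pfactor_dvdn // => l2.
case: ifP => // /allP/(_ p); rewrite mem_primes pp d0 /=.
rewrite -[X in (X %| d)%N](expn1 p) pfactor_dvdn // (ltnW l2) => /(_ isT)/eqP l1.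
by rewrite l1 in l2.
Qed.

(* For a prime p dividing m, the squarefree divisors of m are paired by       *)
(* d <-> p * d with p not dividing d, and the two values of moebius cancel.   *)
Lemma sum_moebius_divisors (m : nat) : (0 < m)%N ->
  \sum_(d <- divisors m) moebius d = (m == 1)%:R.
Proof.
move=> m0; case: (ltngtP m 1) => [|m1|->]; first by rewrite ltnNge m0.
  pose p := pdiv m; have pp : prime p by exact: pdiv_prime.
  have pm : (p %| m)%N by exact: pdiv_dvd.
  rewrite (bigID (fun d => p ^ 2 %| d)%N) /= big1 ?add0r; last first.
    by move=> d /(moebius_square pp).
  rewrite (bigID (fun d => p %| d)%N) /=; apply/eqP; rewrite addr_eq0; apply/eqP.
  rewrite [in RHS](eq_bigl (fun d => ~~ (p %| d)%N)); last first.
    move=> d; case pd: (p %| d)%N => /=; rewrite ?andbF //= andbT.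
    by apply: contraFN pd; apply: dvdn_trans; rewrite dvdn_mulr.
  rewrite -big_filter -[in RHS]big_filter -sumrN.
  rewrite (perm_big [seq (p * d)%N | d <- [seq d <- divisors m | ~~ (p %| d)%N]]).
    rewrite big_map big_seq [RHS]big_seq; apply: eq_bigr => d.
    rewrite mem_filter -dvdn_divisors // => /andP[pd dm].
    by rewrite moebius_primeM // (dvdn_gt0 m0 dm).
  have p0 := prime_gt0 pp.
  apply: uniq_perm; first by rewrite filter_uniq ?divisors_uniq.
    rewrite map_inj_uniq ?filter_uniq ?divisors_uniq // => x y /eqP.
    by rewrite eqn_pmul2l // => /eqP.
  move=> e; rewrite mem_filter -dvdn_divisors //; apply/idP/mapP.
    case/andP=> /andP[p2e /dvdnP[d de]] em; exists d; last by rewrite mulnC.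
    rewrite mem_filter -dvdn_divisors // (dvdn_trans _ em) ?de ?dvdn_mulr // andbT.
    by move: p2e; rewrite de expnS expn1 dvdn_pmul2r.
  case=> d; rewrite mem_filter -dvdn_divisors // => /andP[pd dm] ->.
  rewrite expnS expn1 dvdn_pmul2l // pd dvdn_mulr //=.
  by rewrite Gauss_dvd ?pm // prime_coprime.
by rewrite big_seq1.
Qed.

(** Each multiple m <= N of j is j * k for exactly one k <= N; the other products j * k exceed N,
    where c vanishes. *)
Lemma sum_multiples (V : nmodType) (j N : nat) (c : nat -> V) :
  (0 < j)%N -> (forall m, (N < m)%N -> c m = 0) ->
  \sum_(1 <= k < N.+1) c (j * k)%N = \sum_(1 <= m < N.+1 | (j %| m)%N) c m.
Proof.
move=> j0 cN.
transitivity (\sum_(1 <= k < N.+1) \sum_(1 <= m < N.+1 | m == (j * k)%N) c m).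
  apply: eq_big_nat => k /andP[k0 _]; rewrite big_nat1_eq muln_gt0 j0 k0 ltnS /=.
  by case: leqP => // /cN.
rewrite (exchange_big_dep_nat (fun m => j %| m)%N) /=; last first.
  by move=> k m _ _ _ /eqP ->; rewrite dvdn_mulr.
rewrite [LHS]big_nat_cond [RHS]big_nat_cond.
apply: eq_bigr => m /andP[/andP[m0 mN] /dvdnP[k mk]].
rewrite (eq_bigl (fun i => i == k)) => [|i]; last first.
  by rewrite mk mulnC eqn_pmul2l // eq_sym.
rewrite big_nat1_eq; move: m0 mN; rewrite mk muln_gt0 j0 andbT => -> /=.
by move/(leq_ltn_trans (leq_pmulr k j0)) => ->.
Qed.

(** After exchanging the sums, c m is weighted by the sum of [moebius] over the divisors of m, which
    is 0 unless m = 1. *)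
Lemma moebius_inversion (N : nat) (c : nat -> int) :
  (forall m, (N < m)%N -> c m = 0) ->
  \sum_(1 <= j < N.+1) moebius j * \sum_(1 <= k < N.+1) c (j * k)%N = c 1%N.
Proof.
move=> cN.
transitivity (\sum_(1 <= j < N.+1) \sum_(1 <= m < N.+1 | (j %| m)%N)
    moebius j * c m).
  by apply: eq_big_nat => j /andP[j0 _]; rewrite sum_multiples // big_distrr.
rewrite (exchange_big_dep_nat xpredT) //=.
transitivity (\sum_(1 <= m < N.+1) if m == 1%N then c m else 0).
  apply: eq_big_nat => m /andP[m0 mN]; rewrite -big_distrl /= -big_filter.
  rewrite (perm_big (divisors m)) ?sum_moebius_divisors //.
    by case: eqP; rewrite ?mul1r ?mul0r.
  apply: uniq_perm; rewrite ?filter_uniq ?iota_uniq ?divisors_uniq // => d.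
  rewrite mem_filter mem_index_iota -dvdn_divisors //.
  case dm: (d %| m)%N => //=.
  by rewrite (dvdn_gt0 m0 dm) (leq_ltn_trans (dvdn_leq m0 dm) mN).
rewrite -big_mkcond big_nat1_eq /= ltnS.
(* For N = 0 the sum is empty, and c 1 = 0 by the vanishing hypothesis. *)
by case: N cN => [|N] // ->.
Qed.

Lemma finite_support_bounded (V : nmodType) (N : nat) (F : nat -> V) :
  (forall j, (N < j)%N -> F j = 0) ->
  finite_set (positives `&` [set j | F j != 0]).
Proof.
move=> F0; apply: sub_finite_set (finite_II N.+1) => j [_] /=.
by rewrite ltnS; case: leqP => // /F0 ->; rewrite eqxx.
Qed.

Lemma fsum_bounded (V : nmodType) (N : nat) (F : nat -> V) :
  (forall j, (N < j)%N -> F j = 0) ->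
  \sum_(j \in positives) F j = \sum_(1 <= j < N.+1) F j.
Proof.
move=> F0; rewrite [RHS]fsbig_seq ?iota_uniq //; apply/esym/fsbig_widen => j /=.
  by rewrite mem_index_iota => /andP[].
by case=> j0 /negP; rewrite mem_index_iota j0 ltnS /= -ltnNge; exact: F0.
Qed.

(** The exponent is at least n, and at least a once n > 0. Leaving the denominator arbitrary covers
    both [B_term] and [Bhat_term]. *)
Lemma coef_Xn_div_lt (a n N : nat) (f : fps int) :
  (N < n \/ (0 < n)%N /\ N < a)%N -> ('q ^+ (n ^ 2 + a * n) / f) N = 0.
Proof.
move=> lt; rewrite fps_coefXnM ifT //.
case: lt => [lt|[n0 lt]].
  apply: leq_trans lt (leq_trans _ (leq_addr _ _)).
  by rewrite expnS expn1; case: n => // n; rewrite leq_pmulr.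
by apply: leq_trans lt (leq_trans _ (leq_addl _ _)); rewrite leq_pmulr.
Qed.

Lemma bE (a N : nat) : b a N = \sum_(1 <= n < N.+1) B_term a n N.
Proof. by apply: fsum_bounded => n lt; apply: coef_Xn_div_lt; left. Qed.

Lemma bhatE (a N : nat) : bhat a N = \sum_(1 <= n < N.+1) Bhat_term a n N.
Proof. by apply: fsum_bounded => n lt; apply: coef_Xn_div_lt; left. Qed.

Lemma b_lt (a N : nat) : (N < a)%N -> b a N = 0.
Proof.
move=> lt; rewrite bE big_nat big1 // => n /andP[n0 _].
by apply: coef_Xn_div_lt; right.
Qed.

Lemma bhat_lt (a N : nat) : (N < a)%N -> bhat a N = 0.
Proof.
move=> lt; rewrite bhatE big_nat big1 // => n /andP[n0 _].
by apply: coef_Xn_div_lt; right.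
Qed.

Lemma Bhat_term_geometric (a n M : nat) : (0 < a)%N -> (0 < n)%N ->
  Bhat_term a n =
  \sum_(1 <= j < M.+1) B_term (a * j) n + 'q ^+ (a * n * M) * Bhat_term a n.
Proof.
move=> a0 n0; have an0 : (0 < a * n)%N by rewrite muln_gt0 a0.
elim: M => [|M IH]; first by rewrite big_geq // muln0 expr0 mul1r add0r.
rewrite {1}IH [in RHS]big_nat_recr //= -addrA; congr (_ + _).
(* It remains to see that q^(anM) (1 - q^(an)) [Bhat_term a n] is [B_term (a * M.+1) n]: the factor
   1 - q^(an) cancels and the exponents add up. *)
apply/eqP; rewrite -subr_eq -mulrBl mulnS addnC exprD -{1}['q ^+ _]mulr1.
rewrite -mulrBr -mulrA /Bhat_term /B_term [(1 - _) * _]mulrCA.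
rewrite invrM ?unitrX ?qpoch_unit ?subr_Xn_unit // mulVKr ?subr_Xn_unit //.
rewrite mulrA -exprD; apply/eqP; congr ('q ^+ _ / _).
by rewrite mulnAC mulnS mulnDl addnC -addnA.
Qed.

Lemma Bhat_term_coef (a n N : nat) : (0 < a)%N -> (0 < n)%N ->
  Bhat_term a n N = \sum_(1 <= j < N.+1) B_term (a * j) n N.
Proof.
(* Taking [N.+1] terms, not N, pushes the order of the remainder strictly above N; the extra term j
   = [N.+1] vanishes at N. *)
move=> a0 n0; rewrite (Bhat_term_geometric N.+1 a0 n0) fps_coefD fps_coef_sum.
rewrite fps_coefXnM ifT ?addr0; last first.
  by rewrite mulnC leq_pmulr // muln_gt0 a0.
have B0 : B_term (a * N.+1) n N = 0.
  by apply: coef_Xn_div_lt; right; rewrite leq_pmull.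
by rewrite [LHS]big_nat_recr // B0; exact: addr0.
Qed.

Lemma bhat_sum_b (a N : nat) : (0 < a)%N ->
  bhat a N = \sum_(1 <= j < N.+1) b (a * j) N.
Proof.
move=> a0; rewrite bhatE; under [RHS]eq_bigr do rewrite bE.
rewrite [RHS]exchange_big; apply: eq_big_nat => n /andP[n0 _].
exact: Bhat_term_coef.
Qed.

Lemma b_sum_bhat (a N : nat) : (0 < a)%N ->
  b a N = \sum_(1 <= j < N.+1) moebius j * bhat (a * j) N.
Proof.
move=> a0; have vanish m : (N < m)%N -> b (a * m) N = 0.
  by move=> Nm; apply/b_lt/(leq_trans Nm); rewrite leq_pmull.
(* In the inner sum, a * (j * k) = (a * j) * k, so [bhat_sum_b] at a * j evaluates it. *)
rewrite -[in LHS](muln1 a) -(moebius_inversion vanish).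
apply: eq_big_nat => j /andP[j0 _]; rewrite bhat_sum_b ?muln_gt0 ?a0 //.
by under [in RHS]eq_bigr do rewrite -mulnA.
Qed.

Theorem theorem1p3 :
  (forall a n : nat, (0 < a)%N -> (0 < n)%N ->
     finite_set (positives `&` [set j | b (a * j) n != 0]) /\
     bhat a n = \sum_(j \in positives) b (a * j) n) /\
  (forall a : nat, (0 < a)%N ->
     fps_summable positives (fun n => Bhat (a * n) *~ moebius n) /\
     B a = fps_sum positives (fun n => Bhat (a * n) *~ moebius n)) /\
  (forall a n : nat, (0 < a)%N -> (0 < n)%N ->
     finite_set (positives `&` [set j | moebius j * bhat (a * j) n != 0]) /\
     b a n = \sum_(j \in positives) moebius j * bhat (a * j) n).
Proof.
have lt_mul a j N : (0 < a -> N < j -> N < a * j)%N.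
  by move=> a0 Nj; apply: leq_trans Nj _; rewrite leq_pmull.
have b0 a N : (0 < a)%N -> forall j, (N < j)%N -> b (a * j) N = 0.
  by move=> a0 j Nj; apply/b_lt/lt_mul.
have mbhat0 a N : (0 < a)%N ->
    forall j, (N < j)%N -> moebius j * bhat (a * j) N = 0.
  by move=> a0 j Nj; rewrite bhat_lt ?mulr0 ?lt_mul.
have coefE a N j :
    (Bhat (a * j) *~ moebius j) N = moebius j * bhat (a * j) N.
  by rewrite fps_coefMz -mulrzl intz.
split=> [a N a0 _|].
  split; first exact: finite_support_bounded (b0 a N a0).
  by rewrite (fsum_bounded (b0 a N a0)) bhat_sum_b.
split=> [a a0|a N a0 _]; split.
- by move=> N; apply: (@finite_support_bounded _ N) => j Nj; rewrite coefE mbhat0.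
- apply/fpsP => N; rewrite [RHS](@fsum_bounded _ N) => [|j Nj].
    by under eq_bigr do rewrite coefE; exact: b_sum_bhat.
  by rewrite coefE mbhat0.
- exact: finite_support_bounded (mbhat0 a N a0).
by rewrite (fsum_bounded (mbhat0 a N a0)) b_sum_bhat.
Qed.
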